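(* Let $n\ge2$, $K\ge1$, and let $\mathbf{Y}=(\mathbf{Y}^1,\dots,\mathbf{Y}^n)$ be an i.i.d. sample of integrable random vectors in $\mathbb{R}^K$ with common mean $\mu$, symmetric with respect to $\mu$ (i.e. $\mathbf{Y}^i-\mu$ and $\mu-\mathbf{Y}^i$ have the same distribution). Fix a positive integer $J$, a finite sequence $(\alpha_i)_{i=0,\dots,J-1}$ in $(0,1)$ and $\delta\in(0,1)$. Let $\phi:\mathbb{R}^K\to\mathbb{R}$ be a nonnegative, subadditive, positive-homogeneous function, let $\widetilde\phi(x)=\max(\phi(x),\phi(-x))$, and let $f:(\mathbb{R}^K)^n\to[0,\infty)$ be a nonnegative measurable function. Then $$\mathbb{P}\left[\phi(\overline{\mathbf{Y}}-\mu)>q_{(1-\delta)\alpha_0}(\phi,\mathbf{Y}-\overline{\mathbf{Y}})+\sum_{i=1}^{J-1}\gamma_i\,q_{(1-\delta)\alpha_i}(\widetilde\phi,\mathbf{Y}-\overline{\mathbf{Y}})+\gamma_Jf(\mathbf{Y})\right]\le\sum_{i=0}^{J-1}\alpha_i+\mathbb{P}\big[\widetilde\phi(\overline{\mathbf{Y}}-\mu)>f(\mathbf{Y})\big],$$ where, for $k\ge1$, $\gamma_k=n^{-k}\prod_{i=0}^{k-1}\Big(2\overline{\mathcal B}\big(n,\frac{\alpha_i\delta}{2}\big)-n\Big)$.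
   Context: $\overline{\mathbf{Y}}=\frac1n\sum_{i=1}^n\mathbf{Y}^i$. For a vector $v\in\mathbb{R}^K$, $\mathbf{Y}-v=(\mathbf{Y}^1-v,\dots,\mathbf{Y}^n-v)$. A function $\phi$ is subadditive if $\phi(x+x')\le\phi(x)+\phi(x')$ for all $x,x'$, and positive-homogeneous if $\phi(\lambda x)=\lambda\phi(x)$ for all $x$ and all $\lambda\ge0$. Resampled empirical quantile: for a function $\psi:\mathbb{R}^K\to\mathbb{R}$, $\mathbf{y}=(\mathbf{y}^1,\dots,\mathbf{y}^n)\in(\mathbb{R}^K)^n$ and $\alpha\in(0,1)$, $$q_\alpha(\psi,\mathbf{y})=\inf\{x\in\mathbb{R}:\ \mathbb{P}_W[\psi(\overline{\mathbf{y}}_{[W]})>x]\le\alpha\},\qquad \overline{\mathbf{y}}_{[W]}=\frac1n\sum_{i=1}^nW_i\mathbf{y}^i,$$ where $W=(W_1,\dots,W_n)$ has i.i.d. Rademacher coordinates ($\pm1$ with probability $1/2$ each), independent of the data, and $\mathbb{P}_W$ is the probability over $W$ only ($\mathbf{y}$ fixed). For $\eta\in(0,1)$, $\overline{\mathcal B}(n,\eta)=\min\{k\in\{0,\dots,n\}:\ 2^{-n}\sum_{i=k+1}^n\binom ni<\eta\}$ is the upper quantile function of a binomial $(n,\frac12)$ variable. The sum over $i$ from $1$ to $J-1$ is empty when $J=1$. *)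

(* Defs.v *)
From HB Require Import structures.
From mathcomp Require Import all_boot all_order all_algebra.
From mathcomp Require Import all_classical all_reals all_analysis.

Set Implicit Arguments.
Unset Strict Implicit.
Unset Printing Implicit Defensive.

Import Order.TTheory GRing.Theory Num.Theory.
Import numFieldNormedType.Exports.

Local Open Scope classical_set_scope.
Local Open Scope ring_scope.

(* R^K carries the product sigma-algebra of the Borel sigma-algebra of R, as
   K.-tuple R does in the library; it is the Borel sigma-algebra of R^K. *)
Definition measure_rV_display : measure_display.
Proof. exact: default_measure_display. Qed.

Section measurable_rV.
Context {R : realType} {K : nat}.

Let coors : 'I_K -> 'rV[R]_K -> R := fun j x => x ord0 j.

Let rV_set0 : g_sigma_preimage coors set0.
Proof. exact: sigma_algebra0. Qed.

Let rV_setC A : g_sigma_preimage coors A -> g_sigma_preimage coors (~` A).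
Proof. exact: sigma_algebraC. Qed.

Let rV_bigcup (F : _^nat) : (forall i, g_sigma_preimage coors (F i)) ->
  g_sigma_preimage coors (\bigcup_i (F i)).
Proof. exact: sigma_algebra_bigcup. Qed.

HB.instance Definition _ := @isMeasurable.Build measure_rV_display
  'rV[R]_K (g_sigma_preimage coors) rV_set0 rV_setC rV_bigcup.

End measurable_rV.

Definition mutually_independent (d d' : measure_display)
    (T : measurableType d) (U : measurableType d') (R : realType)
    (P : probability T R) (I : finType) (X : I -> {RV P >-> U}) : Prop :=
  forall (J : {set I}) (A : I -> set U), (forall i, measurable (A i)) ->
    P (\bigcap_(i in [set` J]) (X i @^-1` A i)) =
    (\prod_(i in J) P (X i @^-1` A i))%E.
Arguments mutually_independent {d d' T U R} P {I} X.

Definition same_law (d d' : measure_display)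
    (T : measurableType d) (U : measurableType d') (R : realType)
    (P : probability T R) (X X' : T -> U) : Prop :=
  forall A : set U, measurable A -> pushforward P X A = pushforward P X' A.

Definition iid (d d' : measure_display)
    (T : measurableType d) (U : measurableType d') (R : realType)
    (P : probability T R) (I : finType) (X : I -> {RV P >-> U}) : Prop :=
  mutually_independent P X /\ forall i j, same_law P (X i) (X j).
Arguments iid {d d' T U R} P {I} X.

Definition integrable_vector (d : measure_display) (T : measurableType d)
    (R : realType) (P : probability T R) (K : nat)
    (X : {RV P >-> 'rV[R]_K}) : Prop :=
  forall j, P.-integrable setT (fun t => (X t ord0 j)%:E).
Arguments integrable_vector {d T R} P {K} X.

Definition has_mean (d : measure_display) (T : measurableType d)
    (R : realType) (P : probability T R) (K : nat)
    (X : {RV P >-> 'rV[R]_K}) (mu : 'rV[R]_K) : Prop :=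
  forall j, ('E_P[fun t => X t ord0 j] = (mu ord0 j)%:E)%E.
Arguments has_mean {d T R} P {K} X mu.

Definition symmetric_wrt (d : measure_display) (T : measurableType d)
    (R : realType) (P : probability T R) (K : nat)
    (X : {RV P >-> 'rV[R]_K}) (mu : 'rV[R]_K) : Prop :=
  same_law P (fun t => X t - mu) (fun t => mu - X t).
Arguments symmetric_wrt {d T R} P {K} X mu.

Definition rademacher (d : measure_display) (T : measurableType d)
    (R : realType) (P : probability T R) (w : {RV P >-> R}) : Prop :=
  P (w @^-1` [set 1]) = (2^-1)%:E /\ P (w @^-1` [set -1]) = (2^-1)%:E.
Arguments rademacher {d T R} P w.

Definition subadditive_function (R : realType) (K : nat) (phi : 'rV[R]_K -> R) : Prop :=
  forall x x', phi (x + x') <= phi x + phi x'.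

Definition positive_homogeneous (R : realType) (K : nat)
    (phi : 'rV[R]_K -> R) : Prop :=
  forall (x : 'rV[R]_K) (lambda : R), 0 <= lambda ->
    phi (lambda *: x) = lambda * phi x.

Definition sym_max (R : realType) (K : nat) (phi : 'rV[R]_K -> R)
    (x : 'rV[R]_K) : R :=
  Num.max (phi x) (phi (- x)).

Definition sample (d : measure_display) (T : measurableType d)
    (R : realType) (P : probability T R) (n K : nat)
    (Y : 'I_n -> {RV P >-> 'rV[R]_K}) (t : T) : n.-tuple 'rV[R]_K :=
  [tuple Y i t | i < n].

Definition sample_mean (R : realType) (n K : nat)
    (y : n.-tuple 'rV[R]_K) : 'rV[R]_K :=
  n%:R^-1 *: \sum_(i < n) tnth y i.

Definition shift_sample (R : realType) (n K : nat)
    (y : n.-tuple 'rV[R]_K) (v : 'rV[R]_K) : n.-tuple 'rV[R]_K :=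
  [tuple tnth y i - v | i < n].

Definition weighted_mean (R : realType) (n K : nat)
    (w : 'I_n -> R) (y : n.-tuple 'rV[R]_K) : 'rV[R]_K :=
  n%:R^-1 *: \sum_(i < n) w i *: tnth y i.

(* The weights live on their own probability space, so that PW is the
   probability over W only; the value depends on W through its law only. *)
Definition resampled_quantile (d : measure_display) (Omega : measurableType d)
    (R : realType) (PW : probability Omega R) (n K : nat)
    (W : 'I_n -> {RV PW >-> R}) (a : R) (psi : 'rV[R]_K -> R)
    (y : n.-tuple 'rV[R]_K) : R :=
  inf [set x : R |
    (PW [set o | (x < psi (weighted_mean (fun i => W i o) y))%R]
      <= a%:E)%E].
Arguments resampled_quantile {d Omega R} PW {n K} W a psi y.

(* The set minimised over contains k = n as soon as 0 < eta. *)
Definition binom_upper_quantile (R : realType) (n : nat) (eta : R) : nat :=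
  [arg min_(k < (ord_max : 'I_n.+1) |
     ((2 ^+ n)^-1 * \sum_(k.+1 <= i < n.+1) 'C(n, i)%:R < eta)%R) (k : nat)]%N.

Definition gamma_factor (R : realType) (n : nat) (alpha : nat -> R) (delta : R)
    (k : nat) : R :=
  (n%:R ^+ k)^-1 *
  \prod_(i < k)
    (2 * (binom_upper_quantile n (alpha i * delta / 2))%:R - n%:R).

(* Main.v *)
Require Import Defs.
From HB Require Import structures.
From mathcomp Require Import all_boot all_order all_algebra.
From mathcomp Require Import all_classical all_reals all_analysis.
From mathcomp Require Import measurable_realfun ring lra.

Set Implicit Arguments.
Unset Strict Implicit.
Unset Printing Implicit Defensive.

Import Order.TTheory GRing.Theory Num.Theory.
Import numFieldNormedType.Exports.

Local Open Scope classical_set_scope.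
Local Open Scope ring_scope.

(** The proof is by symmetrization, followed by the removal of the unknown mean
    from the resampled quantile.

    All resampling probabilities are averages over the 2^n sign vectors: this
    is the law of n independent Rademacher variables ([rademacher_probE]), so
    each resampled quantile equals a [sign_quantile].

    Symmetrization ([symmetrized_quantile]).  The centred sample Z, with
    coordinates Y i - mu, keeps its law when some of its coordinates change
    sign, and its sign quantile keeps its value.  Hence the probability that psi of the
    mean of Z exceeds the quantile of order a computed from Z itself does not
    change if the mean of Z is replaced by the mean weighted by a fixed sign
    vector.  Averaging over the sign vectors and exchanging the expectation
    with the finite sum, the definition of the quantile gives the bound a.

    Recentering ([sign_quantile_recenter]).  That quantile uses Y - mu rather
    than Y - Ybar.  The two weighted means differ by the mean of the weights
    times Ybar - mu, which for a sublinear phi costs at most the absolute mean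
    of the weights times sym_max phi (Ybar - mu).  A binomial tail bound
    controls the mean of the weights outside a set of sign vectors of
    probability at most alpha * delta, and this accounts for the passage from alpha to
    (1 - delta) * alpha.  Thus, if sym_max phi (Ybar - mu) <= b, the quantile
    on Y - mu is at most the quantile on Y - Ybar plus g * b, where
    g = (2 * binom_upper_quantile n (alpha * delta / 2) - n) / n.  The product
    of the first k of these factors is gamma_factor of index k.

    Iteration ([iterated_affine_bound]).  Outside the J exceptional events of
    the symmetrization step, of probabilities at most alpha i, and outside
    {sym_max phi (Ybar - mu) > f}, the bound f on sym_max phi (Ybar - mu) is
    successively improved by the quantiles of index J - 1, ..., 1 (the function
    sym_max phi is its own symmetrization), and the last step bounds phi
    itself.  The union bound concludes.

    Monotonicity of the probability requires measurable events, hence a Borel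
    function phi: being sublinear, phi is Lipschitz ([sublinear_measurable]). *)

(** * Sign vectors and their uniform probability *)

Section sign_vectors.
Context {R : realType} {n : nat}.
Implicit Types (A B : {set 'I_n}) (D : pred {set 'I_n}) (v : {set 'I_n} -> R).

(** Sign vectors are indexed by the set of their negative coordinates. *)
Definition signs A : 'I_n -> R := fun i => (-1) ^+ (i \in A).

Definition sign_prob D : R := (2 ^+ n)^-1 * \sum_A (D A)%:R.

(** The symmetric difference: in terms of signs, coordinatewise product. *)
Definition flip_signs B A : {set 'I_n} := [set i | (i \in B) (+) (i \in A)]%SET.

Lemma signs_flip B A i : signs (flip_signs B A) i = signs A i * signs B i.
Proof. by rewrite /signs inE signr_addb mulrC. Qed.

Lemma signs_set0 i : signs finset.set0 i = 1.
Proof. by rewrite /signs inE expr0. Qed.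

Lemma flip_signsK B : involutive (flip_signs B).
Proof. by move=> A; apply/setP => i; rewrite !inE addbA addbb. Qed.

Lemma sum_signs A : \sum_i signs A i = n%:R - 2 * #|A|%:R.
Proof.
rewrite (eq_bigr (fun i => 1 - 2 * (i \in A)%:R)); last first.
  move=> i _; rewrite /signs; case: (i \in A).
    by rewrite expr1 mulr1; lra.
  by rewrite expr0 mulr0 subr0.
rewrite sumrB sumr_const card_ord -mulr_sumr -natr_sum -sum1_card.
by rewrite [in RHS]big_mkcond.
Qed.

Lemma sum_signs_setC A : \sum_i signs (~: A) i = - \sum_i signs A i.
Proof.
rewrite -sumrN; apply: eq_bigr => i _.
by rewrite /signs inE; case: (i \in A); rewrite ?expr0 ?expr1 ?opprK.
Qed.

Lemma sign_prob_le D D' :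
  (forall A, D A -> D' A) -> sign_prob D <= sign_prob D'.
Proof.
move=> DD'; rewrite ler_wpM2l ?invr_ge0 ?exprn_ge0//.
by apply: ler_sum => A _; rewrite ler_nat; move: (DD' A); case: (D A) => // ->.
Qed.

Lemma eq_sign_prob D D' : D =1 D' -> sign_prob D = sign_prob D'.
Proof. by move=> DD'; congr (_ * _); apply: eq_bigr => A _; rewrite DD'. Qed.

Lemma sign_probU D D1 D2 : (forall A, D A -> D1 A || D2 A) ->
  sign_prob D <= sign_prob D1 + sign_prob D2.
Proof.
move=> DU; rewrite -mulrDr ler_wpM2l ?invr_ge0 ?exprn_ge0//.
rewrite -big_split; apply: ler_sum => A _ /=; rewrite -natrD ler_nat.
by move: (DU A); case: (D A) => // /(_ isT); case: (D1 A); case: (D2 A).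
Qed.

Lemma sign_probT : sign_prob predT = 1.
Proof.
rewrite /sign_prob sumr_const -cardsT -powersetT card_powerset cardsT card_ord.
by rewrite natrX mulVf.
Qed.

Lemma sign_prob_flip B D : sign_prob (D \o flip_signs B) = sign_prob D.
Proof.
congr (_ * _); rewrite [RHS](reindex_inj (inv_inj (flip_signsK B))).
exact: eq_bigr.
Qed.

Lemma sign_prob_setC D : sign_prob (fun A => D (~: A)%SET) = sign_prob D.
Proof.
congr (_ * _); rewrite [RHS](reindex_inj (inv_inj (@finset.setCK _))).
exact: eq_bigr.
Qed.

(** The infimum defining a quantile is attained: there are finitely many values
    v A, so the probability of exceeding x is right-continuous in x.  Hence a
    bound on a quantile is a condition on a single probability. *)
Lemma sign_prob_inf_le (a : R) v (z : R) : 0 <= a < 1 ->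
  (inf [set x | sign_prob (fun A => x < v A) <= a] <= z) =
  (sign_prob (fun A => z < v A) <= a).
Proof.
case/andP=> a0 a1; set S := [set x | _].
have S_up x y : x <= y -> S x -> S y.
  move=> xy; apply: le_trans; apply: sign_prob_le => A.
  exact: le_lt_trans.
(* Beyond M nothing is exceeded; below - M everything is, with
   probability 1 > a; so S is nonempty and bounded below. *)
pose M := \sum_A `|v A|.
have vM A : `|v A| <= M by rewrite /M (bigD1 A)//= lerDl sumr_ge0.
have S_M : S M.
  rewrite /S /= (le_trans _ a0)// /sign_prob big1 ?mulr0// => A _.
  by rewrite ltNge (le_trans (ler_norm _) (vM A)).
have S_lb : lbound S (- M - 1).
  move=> x Sx; rewrite leNgt; apply/negP => xM.
  suff : sign_prob predT <= a by rewrite sign_probT leNgt a1.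
  apply: le_trans Sx; apply: sign_prob_le => A _.
  apply: (lt_le_trans xM); have := vM A; rewrite ler_norml => /andP[+ _].
  lra.
have hS : has_inf S by split; [exists M | exists (- M - 1)].
(* Just above inf S, by less than e, no new value v A is passed. *)
suff Sinf : S (inf S).
  apply/idP/idP => [|Sz]; first by move/S_up; apply.
  by apply: ge_inf Sz; case: hS.
pose e := \big[Num.min/1]_(A | inf S < v A) (v A - inf S).
have e0 : 0 < e.
  rewrite /e; elim/big_ind : _ => // [x y x0 y0|A].
    by rewrite lt_min x0.
  by rewrite subr_gt0.
have [x Sx xe] := inf_adherent e0 hS.
apply: le_trans Sx; apply: sign_prob_le => A vA; apply: (lt_le_trans xe).
by rewrite -lerBrDl /e (bigD1 A)//= ge_min lexx.
Qed.

End sign_vectors.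

(** The resampled quantile of a Rademacher weight vector, without reference to a
    probability space carrying the weights. *)
Definition sign_quantile {R : realType} {n K : nat} (a : R)
    (psi : 'rV[R]_K -> R) (y : n.-tuple 'rV[R]_K) : R :=
  inf [set x | sign_prob (fun A => x < psi (weighted_mean (signs A) y)) <= a].

(** * The law of Rademacher weights *)

Section rademacher_law.
Context {R : realType} {dW : measure_display} {Omega : measurableType dW}.
Context {PW : probability Omega R} {n : nat} {W : 'I_n -> {RV PW >-> R}}.
Hypotheses (W_iid : iid PW W) (W_rademacher : forall i, rademacher PW (W i)).
Implicit Types (A : {set 'I_n}) (D : ('I_n -> R) -> bool).

Let atom A : set Omega :=
  \bigcap_(i in [set` [set: 'I_n]%SET]) (W i @^-1` [set signs A i]).

Let measurable_atom A : measurable (atom A).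
Proof.
apply: fin_bigcap_measurable => [|i _]; first exact: finite_finset.
by rewrite -[X in measurable X]setTI; apply: measurable_funP.
Qed.

Let atomE A o : atom A o -> (fun i => W i o) = signs A.
Proof. by move=> Ao; apply/funext => i; apply: Ao; rewrite /= inE. Qed.

Let signs_inj A B : @signs R n A = signs B -> A = B.
Proof.
move=> AB; apply/setP => i; have /eqP := congr1 (@^~ i) AB.
rewrite /signs; case: (i \in A); case: (i \in B) => //; rewrite expr0 expr1.
  by rewrite -subr_eq0 -opprD oppr_eq0 (_ : 1 + 1 = 2%:R)// pnatr_eq0.
by rewrite -subr_eq0 opprK (_ : 1 + 1 = 2%:R)// pnatr_eq0.
Qed.

Let PW_atom A : PW (atom A) = ((2 ^+ n)^-1)%:E.
Proof.
rewrite (proj1 W_iid) => [|i]; last exact: measurable_set1.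
rewrite (eq_bigr (fun=> (2^-1 : R)%:E)).
  by rewrite prodEFin prodr_const cardsT card_ord exprVn.
move=> i _; have [W1 WN1] := W_rademacher i.
by rewrite /signs; case: (i \in A); rewrite ?expr0 ?expr1.
Qed.

(** The atoms selected by D are disjoint and included in the event. *)
Let sign_prob_le_law D : measurable [set o | D (fun i => W i o)] ->
  ((sign_prob (D \o signs))%:E <= PW [set o | D (fun i => W i o)])%E.
Proof.
move=> mD; pose s := [seq A <- index_enum _ | D (signs A)].
have us : uniq s by rewrite filter_uniq ?index_enum_uniq.
have -> : (sign_prob (D \o signs))%:E = (\sum_(A <- s) PW (atom A))%E.
  rewrite big_filter; under eq_bigr do rewrite PW_atom.
  rewrite sumEFin /sign_prob mulr_sumr; congr EFin.
  rewrite [RHS]big_mkcond /=; apply: eq_bigr => A _.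
  by case: (D _); rewrite ?mulr1 ?mulr0.
rewrite fsbig_seq ?us// -measure_fsbig//; first last.
- move=> A B _ _ [] x [Ax Bx]; apply: signs_inj.
  by rewrite -(atomE Ax) (atomE Bx).
apply: le_measure; rewrite ?inE//.
  by rewrite -fsbig_seq ?us//; apply: bigsetU_measurable.
rewrite -fsbig_seq ?us// -bigcup_seq => o [A /=].
by rewrite mem_filter => /andP[+ _] Ao; rewrite /= (atomE Ao).
Qed.

(** The lower bound for D and for its complement add up to 1 on both sides, so
    both are equalities. *)
Lemma rademacher_probE D : measurable [set o | D (fun i => W i o)] ->
  PW [set o | D (fun i => W i o)] = (sign_prob (D \o signs))%:E.
Proof.
move=> mD; apply/eqP; rewrite eq_le sign_prob_le_law// andbT.
pose D' w := ~~ D w.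
have D'E : [set o | D' (fun i => W i o)] = ~` [set o | D (fun i => W i o)].
  by apply/seteqP; split=> o /= /negP.
have mD' : measurable [set o | D' (fun i => W i o)].
  by rewrite D'E; exact: measurableC.
have := sign_prob_le_law mD'.
rewrite D'E probability_setC//.
have -> : sign_prob (D' \o signs) = 1 - sign_prob (D \o signs) :> R.
  apply/eqP; rewrite eq_sym subr_eq -(@sign_probT R n) /sign_prob.
  rewrite -mulrDr -big_split /=.
  apply/eqP; congr (_ * _); apply: eq_bigr => A _.
  by rewrite /= /D'; case: (D _); rewrite ?addr0 ?add0r.
have : PW [set o | D (fun i => W i o)] \is a fin_num by exact: fin_num_measure.
move/fineK <-; rewrite -EFinB !lee_fin; lra.
Qed.

End rademacher_law.

(** * Measurability of sublinear functions on row vectors *)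

Lemma measurable_lt_set {R : realType} {d : measure_display}
    {T : measurableType d} (f g : T -> R) :
  measurable_fun setT f -> measurable_fun setT g ->
  measurable [set t | f t < g t].
Proof.
move=> mf mg; have := measurable_fun_ltr mf mg measurableT (Y := [set true]).
by rewrite setTI preimage_true; apply.
Qed.

Section measurable_row_vectors.
Context {R : realType} {K : nat}.

Lemma measurable_coord (j : 'I_K) :
  measurable_fun setT (fun x : 'rV[R]_K => x ord0 j).
Proof.
move=> _ B mB; rewrite setTI; apply: sub_sigma_algebra => /=.
rewrite -bigcup_seq /=; exists j; first by rewrite /= mem_index_enum.
by exists B => //; rewrite setTI.
Qed.

Lemma measurable_fun_rVP {d : measure_display} {T : measurableType d}
    (f : T -> 'rV[R]_K) :
  (forall j, measurable_fun setT (fun t => f t ord0 j)) ->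
  measurable_fun setT f.
Proof.
move=> mf; apply: (measurability (\big[setU/set0]_(j < K)
  preimage_set_system setT (fun x : 'rV[R]_K => x ord0 j) measurable)) => //.
move=> _ [B + <-]; rewrite -bigcup_seq => -[j _ [C mC <-]].
by rewrite !setTI; have := mf j measurableT C mC; rewrite setTI.
Qed.

End measurable_row_vectors.

Section sublinear.
Context {R : realType} {K : nat} (phi : 'rV[R]_K -> R).
Hypotheses (phi_subadditive : subadditive_function phi).
Hypotheses (phi_homogeneous : positive_homogeneous phi).

Lemma le_sym_max x : phi x <= sym_max phi x.
Proof. by rewrite /sym_max le_max lexx. Qed.

Lemma le_sym_maxN x : phi (- x) <= sym_max phi x.
Proof. by rewrite /sym_max le_max lexx orbT. Qed.

Let phi0 : phi 0 = 0.
Proof. by rewrite -(scale0r (0 : 'rV[R]_K)) phi_homogeneous// mul0r. Qed.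

Lemma sublinear_sum (I : Type) (r : seq I) (x : I -> 'rV[R]_K) :
  phi (\sum_(i <- r) x i) <= \sum_(i <- r) phi (x i).
Proof.
elim: r => [|i r IH]; first by rewrite !big_nil phi0.
by rewrite !big_cons (le_trans (phi_subadditive _ _))// lerD2l.
Qed.

Lemma sublinear_scale (c : R) (x : 'rV[R]_K) :
  phi (c *: x) <= `|c| * sym_max phi x.
Proof.
have [c0|c0] := leP 0 c.
  by rewrite phi_homogeneous// ger0_norm// ler_wpM2l// le_sym_max.
rewrite -[c]opprK scaleNr -scalerN phi_homogeneous; last by rewrite oppr_ge0 ltW.
by rewrite opprK ltr0_norm// ler_wpM2l ?le_sym_maxN// oppr_ge0 ltW.
Qed.

Let L : R := \sum_j `|sym_max phi (delta_mx 0 j)|.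

Let lipschitz x y : phi x <= phi y + L * \sum_j `|x ord0 j - y ord0 j|.
Proof.
rewrite -lerBlDl (@le_trans _ _ (phi (x - y)))//.
  by rewrite lerBlDl; have := phi_subadditive y (x - y); rewrite addrC subrK.
rewrite [x - y]row_sum_delta (le_trans (sublinear_sum _ _))// mulr_sumr.
apply: ler_sum => j _; rewrite (le_trans (sublinear_scale _ _))// !mxE mulrC.
rewrite ler_wpM2r// (le_trans (ler_norm _))//.
by rewrite /L (bigD1 j)//= lerDl sumr_ge0.
Qed.

(** A Lipschitz function is below c at x exactly when it is so at some rational
    vector by a margin exceeding the variation allowed between the two points;
    this writes the sublevel set as a countable union of measurable sets. *)
Lemma sublinear_measurable : measurable_fun setT phi.
Proof.
apply: (measurability _ (RGenInftyO.measurableE R)) => //.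
move=> _ [_ [c ->] <-]; rewrite setTI.
pose ball (r : 'rV[rat]_K) : set 'rV[R]_K :=
  [set x | phi (map_mx ratr r) + L * \sum_j `|x ord0 j - ratr (r ord0 j)| < c].
rewrite (_ : _ @^-1` _ = \bigcup_r ball r); last first.
  apply/seteqP; split => x /=; rewrite in_itv /=; last first.
    move=> [r _]; apply: le_lt_trans.
    rewrite (le_trans (lipschitz _ (map_mx ratr r)))//.
    by under eq_bigr do rewrite mxE.
  move=> xc.
  (* If |x_j - r_j| < e for all j, then L * |x - r|_1 is less than half of
     c - phi x; this term enters twice, in the definition of ball and when phi r
     is bounded in terms of phi x.  The added 1s keep the denominator positive. *)
  pose e := (c - phi x) / (2 * (L + 1) * K.+1%:R).
  have L0 : 0 <= L by apply: sumr_ge0.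
  have K0 : 0 < K.+1%:R :> R by rewrite ltr0n.
  have e0 : 0 < e by rewrite divr_gt0 ?subr_gt0// !mulr_gt0// ltr_wpDl.
  have /choice[r rP] j : exists q : rat, `|x ord0 j - ratr q| < e.
    have /rat_in_itvoo[q] : x ord0 j - e < x ord0 j + e by lra.
    rewrite in_itv /= => /andP[q1 q2]; exists q.
    by rewrite ltr_norml; apply/andP; split; lra.
  exists (\row_j r j) => //; rewrite /ball /=.
  set S := \sum_j _; set r' := map_mx _ _.
  have phir : phi r' <= phi x + L * S.
    rewrite (le_trans (lipschitz _ x))// lerD2l ler_wpM2l// ler_sum// => j _.
    by rewrite !mxE distrC.
  have SK : S <= K%:R * e.
    rewrite (_ : K%:R * e = \sum_(j < K) e).
      by apply: ler_sum => j _; rewrite mxE ltW.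
    by rewrite sumr_const card_ord mulr_natl.
  have eE : 2 * (L + 1) * (K.+1%:R * e) = c - phi x.
    by rewrite mulrA mulrC divfK// gt_eqF// !mulr_gt0// ltr_wpDl.
  move: eE; rewrite -natr1 mulrDl mul1r.
  have : L * S <= L * (K%:R * e) by rewrite ler_wpM2l.
  have : 0 <= K%:R * e by rewrite mulr_ge0 ?ler0n// ltW.
  have := mulr_ge0 L0 (ltW e0).
  lra.
apply: countable_bigcupT_measurable => [|r]; first exact: countableP.
apply: measurable_lt_set => //.
apply: measurable_funD => //; apply: measurable_funM => //.
apply: measurable_sum => j; apply: measurableT_comp => //.
by apply: measurable_funB => //; exact: measurable_coord.
Qed.

End sublinear.

Section sym_max.
Context {R : realType} {K : nat} (phi : 'rV[R]_K -> R).
Hypotheses (phi_subadditive : subadditive_function phi).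
Hypotheses (phi_homogeneous : positive_homogeneous phi).

Lemma sym_max_subadditive : subadditive_function (sym_max phi).
Proof.
move=> x y; rewrite /sym_max ge_max opprD.
rewrite (le_trans (phi_subadditive x y)) ?lerD ?le_max ?lexx//=.
by rewrite (le_trans (phi_subadditive (- x) (- y))) ?lerD ?le_max ?lexx ?orbT.
Qed.

Lemma sym_max_homogeneous : positive_homogeneous (sym_max phi).
Proof.
move=> x c c0; rewrite /sym_max -scalerN !phi_homogeneous//.
by rewrite maxr_pMr.
Qed.

Lemma sym_max_idem : sym_max (sym_max phi) = sym_max phi.
Proof.
by apply/funext => x; rewrite /sym_max opprK [X in Num.max _ X]maxC maxxx.
Qed.

End sym_max.

(** * Resampled quantiles as sign quantiles *)

Lemma measurable_weighted_mean_weights {R : realType} {n K : nat}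
    {d : measure_display} {T : measurableType d} (w : 'I_n -> T -> R)
    (y : n.-tuple 'rV[R]_K) : (forall i, measurable_fun setT (w i)) ->
  measurable_fun setT (fun t => weighted_mean (w^~ t) y).
Proof.
move=> mw; apply: measurable_fun_rVP => j.
under eq_fun do rewrite mxE summxE.
apply: measurable_funM => //; apply: measurable_sum => i.
by under eq_fun do rewrite mxE; apply: measurable_funM.
Qed.

Lemma measurable_weighted_mean {R : realType} {n K : nat} (w : 'I_n -> R) :
  measurable_fun setT (fun y : n.-tuple 'rV[R]_K => weighted_mean w y).
Proof.
apply: measurable_fun_rVP => j.
under eq_fun do rewrite mxE summxE.
apply: measurable_funM => //; apply: measurable_sum => i.
under eq_fun do rewrite mxE; apply: measurable_funM => //.
exact: (measurableT_comp (measurable_coord j) (@measurable_tnth _ _ _ i)).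
Qed.

Lemma resampled_quantileE {R : realType} {dW : measure_display}
    {Omega : measurableType dW} (PW : probability Omega R) {n K : nat}
    (W : 'I_n -> {RV PW >-> R}) (a : R) (psi : 'rV[R]_K -> R)
    (y : n.-tuple 'rV[R]_K) :
  iid PW W -> (forall i, rademacher PW (W i)) -> measurable_fun setT psi ->
  resampled_quantile PW W a psi y = sign_quantile a psi y.
Proof.
move=> W_iid W_rad mpsi; congr inf; apply/seteqP; split => x /=.
all: rewrite (rademacher_probE W_iid W_rad
  (D := fun w => x < psi (weighted_mean w y))) ?lee_fin//.
all: apply: measurable_lt_set => //; apply: measurableT_comp => //.
all: by apply: measurable_weighted_mean_weights => i.
Qed.

(** A superlevel set of the quantile compares a constant with a finite sum of
    indicators. *)
Lemma sign_quantile_measurable {R : realType} {n K : nat} (a : R)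
    (psi : 'rV[R]_K -> R) : 0 <= a < 1 -> measurable_fun setT psi ->
  measurable_fun setT (@sign_quantile R n K a psi).
Proof.
move=> a01 mpsi; apply: (measurability _ (RGenOInfty.measurableE R)) => //.
move=> _ [_ [x ->] <-]; rewrite setTI.
rewrite (_ : _ @^-1` _ = [set y | a <
    sign_prob (fun A => x < psi (weighted_mean (signs A) y))]); last first.
  by apply/seteqP; split=> y /=; rewrite in_itv/= andbT !ltNge sign_prob_inf_le.
apply: measurable_lt_set => //; apply: measurable_funM => //.
apply: measurable_sum => A.
have mlt : measurable_fun setT
    (fun y : n.-tuple 'rV[R]_K => x < psi (weighted_mean (signs A) y)).
  apply: measurable_fun_ltr => //; apply: measurableT_comp => //.
  exact: measurable_weighted_mean.
have -> : (fun y : n.-tuple 'rV[R]_K => (x < psi (weighted_mean (signs A) y))%R%:R) =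
  (fun y => if x < psi (weighted_mean (signs A) y) then 1 else 0) :> (_ -> R).
  by apply/funext => y; case: ifP.
exact: measurable_fun_ifT.
Qed.

Definition flip_sample {R : realType} {n K : nat} (B : {set 'I_n})
    (z : n.-tuple 'rV[R]_K) : n.-tuple 'rV[R]_K :=
  [tuple signs B i *: tnth z i | i < n].

Lemma weighted_mean_flip {R : realType} {n K : nat} (A B : {set 'I_n})
    (z : n.-tuple 'rV[R]_K) :
  weighted_mean (signs A) (flip_sample B z) =
  weighted_mean (signs (flip_signs B A)) z.
Proof.
congr (_ *: _); apply: eq_bigr => i _.
by rewrite tnth_mktuple scalerA signs_flip.
Qed.

Lemma sample_mean_flip {R : realType} {n K : nat} (B : {set 'I_n})
    (z : n.-tuple 'rV[R]_K) :
  sample_mean (flip_sample B z) = weighted_mean (signs B) z.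
Proof. by congr (_ *: _); apply: eq_bigr => i _; rewrite tnth_mktuple. Qed.

Lemma sign_quantile_flip {R : realType} {n K : nat} (a : R)
    (psi : 'rV[R]_K -> R) (B : {set 'I_n}) (z : n.-tuple 'rV[R]_K) :
  sign_quantile a psi (flip_sample B z) = sign_quantile a psi z.
Proof.
congr inf; apply: eq_set => x; congr (_ <= _).
rewrite -[RHS](sign_prob_flip B); apply: eq_sign_prob => A /=.
by rewrite weighted_mean_flip.
Qed.

(** * The binomial tail *)

Lemma sign_prob_card_gt {R : realType} {n : nat} (k : nat) :
  sign_prob (fun A : {set 'I_n} => k < #|A|)%N =
  (2 ^+ n)^-1 * \sum_(k.+1 <= i < n.+1) 'C(n, i)%:R :> R.
Proof.
congr (_ * _).
rewrite (eq_bigr (fun A : {set 'I_n} => \sum_(k.+1 <= i < n.+1) (#|A| == i)%:R)).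
  rewrite exchange_big /=; apply: eq_bigr => i _.
  have -> : 'C(n, i) = #|[set A : {set 'I_n} | #|A| == i]%SET|.
    by rewrite card_draws card_ord.
  rewrite -natr_sum -sum1_card [in RHS]big_mkcond /=.
  by congr (_%:R); apply: eq_bigr => A _; rewrite inE; case: eqP.
move=> A _; have An : (#|A| < n.+1)%N by rewrite ltnS -[leqRHS]card_ord max_card.
have [kA|kA] := ltnP k #|A|.
  rewrite (big_rem #|A|) ?mem_index_iota ?kA//= eqxx big1_seq ?addr0// => i.
  by rewrite mem_rem_uniq ?iota_uniq// inE eq_sym => /andP[_ /andP[/negPf-> _]].
rewrite big1_seq// => i; rewrite mem_index_iota => /andP[_ /andP[ki _]].
by rewrite ltn_eqF// (leq_ltn_trans kA).
Qed.

Section binom_upper_quantile.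
Context {R : realType} {n : nat} (eta : R).
Hypothesis eta0 : 0 < eta.
Let k := binom_upper_quantile n eta.

Lemma binom_upper_quantile_tail :
  sign_prob (fun A : {set 'I_n} => k < #|A|)%N < eta.
Proof.
rewrite sign_prob_card_gt /k /binom_upper_quantile.
case: arg_minnP => //.
by rewrite big_geq// mulr0.
Qed.

(** The sum of the signs is n minus twice the number of minus signs, so it is
    large in absolute value only if there are many minus signs or many plus
    signs; the two cases are exchanged by complementation. *)
Lemma sign_prob_sum_signs_gt :
  sign_prob (fun A : {set 'I_n} => 2 * k%:R - n%:R < `|\sum_i signs A i| :> R)
  < eta *+ 2.
Proof.
apply: le_lt_trans (_ : _ <= sign_prob (fun A : {set 'I_n} => k < #|A|)%N +
                          sign_prob (fun A : {set 'I_n} => k < #|~: A|%SET)%N) _.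
  apply: sign_probU => A.
  have gtk (B : {set 'I_n}) : 2 * k%:R - n%:R < - \sum_i signs B i :> R ->
      (k < #|B|)%N.
    by rewrite sum_signs opprB ltrD2r ltr_pM2l// ltr_nat.
  rewrite ltr_normr => /orP[sA|/gtk -> //].
  by rewrite [X in _ || X]gtk ?orbT// sum_signs_setC opprK.
rewrite [X in _ + X](_ : _ = sign_prob (fun A : {set 'I_n} => k < #|A|)%N).
  by rewrite -mulr2n ltrMn2r binom_upper_quantile_tail.
exact: sign_prob_setC (fun A : {set 'I_n} => k < #|A|)%N.
Qed.

(** Otherwise the two-sided tail above would have a negative threshold, hence
    probability 1, which is not less than 2 * eta as eta <= 1/2. *)
Lemma binom_upper_quantile_ge : eta <= 2^-1 -> n%:R <= 2 * k%:R :> R.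
Proof.
move=> eta2; rewrite leNgt; apply/negP => kn.
have : @sign_prob R n predT < eta *+ 2.
  apply: le_lt_trans sign_prob_sum_signs_gt; apply: sign_prob_le => A _.
  by rewrite (@lt_le_trans _ _ 0)// subr_lt0.
rewrite sign_probT mulr2n; lra.
Qed.

End binom_upper_quantile.

(** * Symmetrization *)

(** The measurable rectangles form a pi-system generating the product
    sigma-algebra. *)
Lemma eq_tuple_law {R : realType} {d d' : measure_display}
    {T : measurableType d} {U : measurableType d'} (P : probability T R)
    {n : nat} (f g : T -> n.-tuple U) :
  measurable_fun setT f -> measurable_fun setT g ->
  (forall A : 'I_n -> set U, (forall i, measurable (A i)) ->
    P [set t | forall i, A i (tnth (f t) i)] =
    P [set t | forall i, A i (tnth (g t) i)]) ->
  forall B, measurable B -> P (f @^-1` B) = P (g @^-1` B).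
Proof.
move=> mf mg fg.
pose G : set (set (n.-tuple U)) := [set B | exists2 A : 'I_n -> set U,
  forall i, measurable (A i) & B = [set z | forall i, A i (tnth z i)]].
have rectE (A : 'I_n -> set U) :
    [set z : n.-tuple U | forall i, A i (tnth z i)] =
    \bigcap_(i in setT) ((@tnth n U)^~ i @^-1` A i).
  by apply/seteqP; split => z /= zA i; [move=> _|]; apply: zA.
have Gm : G `<=` measurable.
  move=> _ [A mA ->]; rewrite rectE; apply: fin_bigcap_measurable => [|i _].
    exact: finite_finset.
  by rewrite -[X in measurable X]setTI; exact: measurable_tnth.
have mG : measurable `<=` <<s G >>.
  apply: smallest_sub; first exact: smallest_sigma_algebra.
  move=> B; rewrite -bigcup_seq => -[i _ [C mC <-]]; apply: sub_sigma_algebra.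
  exists (fun j => if j == i then C else setT) => [j|]; first by case: ifP.
  rewrite setTI; apply/seteqP; split => z /=; last by move/(_ i); rewrite eqxx.
  by move=> Cz j; case: eqP => // ->.
move=> B mB.
pose mu_f := distribution P (mfun_Sub (mem_set mf)).
pose mu_g := distribution P (mfun_Sub (mem_set mg)).
apply: (g_sigma_algebra_measure_unique G Gm (fun=> setT) _ _ mu_f mu_g) => //.
- by move=> _; exists (fun=> setT) => //; apply/esym/seteqP; split.
- by rewrite bigcup_const.
- move=> _ _ [A mA ->] [A' mA' ->]; exists (fun i => A i `&` A' i).
    by move=> i; exact: measurableI.
  apply/seteqP; split=> z /=; first by move=> -[zA zA'] i; split.
  by move=> zA; split => i; case: (zA i).
- by move=> _ [A mA ->]; exact: fg.
- by move=> _; exact: le_lt_trans (probability_le1 mu_f measurableT) (ltry 1).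
- exact: mG.
Qed.

Lemma measurable_shift_sample {R : realType} {n K : nat}
    (v : n.-tuple 'rV[R]_K -> 'rV[R]_K) : measurable_fun setT v ->
  measurable_fun setT (fun y => shift_sample y (v y)).
Proof.
move=> mv; apply/measurable_fun_tnthP => i; apply: measurable_fun_rVP => j.
under eq_fun do rewrite /= tnth_mktuple !mxE.
apply: measurable_funB; last exact: (measurableT_comp (measurable_coord j) mv).
exact: (measurableT_comp (measurable_coord j) (@measurable_tnth _ _ _ i)).
Qed.

Section symmetrization.
Context {R : realType} {d : measure_display} {T : measurableType d}.
Context {P : probability T R} {n K : nat} {Y : 'I_n -> {RV P >-> 'rV[R]_K}}.
Context {mu : 'rV[R]_K}.
Hypotheses (Y_independent : mutually_independent P Y).
Hypotheses (Y_symmetric : forall i, symmetric_wrt P (Y i) mu).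

Let Z t := shift_sample (sample Y t) mu.

Lemma measurable_sample : measurable_fun setT (sample Y).
Proof.
apply/measurable_fun_tnthP => i.
by rewrite (_ : _ \o _ = Y i)//; apply/funext => t /=; rewrite tnth_mktuple.
Qed.

Lemma measurable_flip (A : {set 'I_n}) :
  measurable_fun setT (@flip_sample R n K A).
Proof.
apply/measurable_fun_tnthP => i; apply: measurable_fun_rVP => j.
under eq_fun do rewrite /= tnth_mktuple mxE.
apply: measurable_funM => //.
exact: (measurableT_comp (measurable_coord j) (@measurable_tnth _ _ _ i)).
Qed.

Let mZ : measurable_fun setT Z.
Proof.
exact: measurableT_comp (measurable_shift_sample (measurable_cst mu))
  measurable_sample.
Qed.

(** By independence the law of the centred sample is determined by its
    marginals, which are symmetric. *)
Lemma flip_sample_law (A : {set 'I_n}) (B : set (n.-tuple 'rV[R]_K)) :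
  measurable B -> P ((@flip_sample R n K A \o Z) @^-1` B) = P (Z @^-1` B).
Proof.
move: B; apply: eq_tuple_law => //.
  exact: measurableT_comp (measurable_flip A) mZ.
move=> C mC.
have maff s : measurable_fun setT (fun y : 'rV[R]_K => s *: (y - mu)).
  apply: measurable_fun_rVP => j; under eq_fun do rewrite !mxE.
  apply: measurable_funM => //; apply: measurable_funD => //.
  exact: measurable_coord.
pose C' (s : R) i : set 'rV[R]_K := (fun y => s *: (y - mu)) @^-1` C i.
have mC' s i : measurable (C' s i).
  by rewrite -[C' s i]setTI; exact: maff.
have rectE (s : 'I_n -> R) : [set t | forall i, C i (s i *: (Y i t - mu))] =
    \bigcap_(i in [set` [set: 'I_n]%SET]) (Y i @^-1` C' (s i) i).
  by apply/seteqP; split => t /= tC i; [move=> _|]; apply: tC; rewrite /= ?inE.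
have -> : [set t | forall i, C i (tnth ((flip_sample A \o Z) t) i)] =
    [set t | forall i, C i (signs A i *: (Y i t - mu))].
  by apply/seteqP; split => t /= tC i; have := tC i; rewrite !tnth_mktuple.
have -> : [set t | forall i, C i (tnth (Z t) i)] =
    [set t | forall i, C i ((fun=> 1) i *: (Y i t - mu))].
  apply/seteqP; split => t /= tC i; have := tC i;
  by rewrite !tnth_mktuple scale1r.
rewrite !rectE !Y_independent//; apply: eq_bigr => i _.
rewrite /signs; case: (i \in A); last by rewrite expr0.
rewrite expr1; have := Y_symmetric i (mC i); rewrite /pushforward => YC.
have -> : Y i @^-1` C' (-1) i = (fun t => mu - Y i t) @^-1` C i.
  by apply/seteqP; split => t; rewrite /C' /= scaleN1r opprB.
rewrite -YC; congr (P _).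
by apply/seteqP; split => t; rewrite /C' /= scale1r.
Qed.

(** All the events B A below have the same probability p, and at each point at
    most a fraction a of them occur, by definition of the quantile. *)
Lemma symmetrized_quantile (a : R) (psi : 'rV[R]_K -> R) :
  0 <= a < 1 -> measurable_fun setT psi ->
  (P [set t | (sign_quantile a psi (Z t) < psi (sample_mean (Z t)))%R] <= a%:E)%E.
Proof.
move=> a01 mpsi.
pose B A : set (n.-tuple 'rV[R]_K) :=
  [set z | sign_quantile a psi z < psi (weighted_mean (signs A) z)].
have mB A : measurable (B A).
  apply: measurable_lt_set; first exact: sign_quantile_measurable.
  by apply: measurableT_comp => //; exact: measurable_weighted_mean.
have mean0 (z : n.-tuple 'rV[R]_K) :
    sample_mean z = weighted_mean (signs finset.set0) z.
  by congr (_ *: _); apply: eq_bigr => i _; rewrite signs_set0 scale1r.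
have -> : [set t | sign_quantile a psi (Z t) < psi (sample_mean (Z t))] =
    Z @^-1` B finset.set0.
  by apply/seteqP; split => t /=; rewrite /B /= mean0.
set p := P _.
have PB A : P (Z @^-1` B A) = p.
  rewrite /p -[RHS](flip_sample_law A)//; congr (P _).
  apply/seteqP; split => t;
  by rewrite /B /= -mean0 sample_mean_flip sign_quantile_flip.
have mZB A : measurable (Z @^-1` B A).
  by rewrite -[X in measurable X]setTI; exact: mZ.
pose E A := Z @^-1` B A.
have sumE t : \sum_A \1_(E A) t <= 2 ^+ n * a.
  rewrite -ler_pdivrMl ?exprn_gt0//.
  have := lexx (sign_quantile a psi (Z t)); rewrite {1}/sign_quantile.
  rewrite sign_prob_inf_le//; apply: le_trans; rewrite le_eqVlt; apply/orP; left.
  apply/eqP; congr (_ * _); apply: eq_bigr => A _; rewrite indicE.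
  by congr (_%:R); congr nat_of_bool; apply/idP/idP; rewrite inE.
have : (\int[P]_t \sum_A (\1_(E A) t)%:E <= \int[P]_t (2 ^+ n * a)%:E)%E.
  apply: ge0_le_integral => //.
  - by move=> t _; apply: sume_ge0 => A _; rewrite lee_fin.
  - apply: emeasurable_sum => A; apply/measurable_EFinP.
    exact/measurable_indic/mZB.
  - by move=> t _; rewrite sumEFin lee_fin.
rewrite integral_cst// [X in (_ * X)%E](probability_setT P) mule1.
rewrite ge0_integral_sum//; last first.
  by move=> A; apply/measurable_EFinP; exact/measurable_indic/mZB.
rewrite (eq_bigr (fun=> p)) => [|A _]; last first.
  by rewrite integral_indic ?setIT; [exact: PB| |exact: mZB].
have /fineK <- : p \is a fin_num by exact: fin_num_measure.
rewrite sumEFin !lee_fin sumr_const -cardsT -powersetT card_powerset cardsT.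
by rewrite card_ord -[_ *+ (2 ^ n)%N]mulr_natl natrX ler_pM2l// exprn_gt0.
Qed.
End symmetrization.

(** * Removing the unknown mean *)

Section recentering.
Context {R : realType} {n K : nat}.
Hypothesis n_gt0 : (0 < n)%N.
Implicit Types (y : n.-tuple 'rV[R]_K) (mu : 'rV[R]_K).

Lemma sample_mean_shift y mu :
  sample_mean (shift_sample y mu) = sample_mean y - mu.
Proof.
rewrite /sample_mean; under eq_bigr do rewrite tnth_mktuple.
rewrite sumrB sumr_const card_ord scalerBr -[mu *+ n]scaler_nat scalerA.
by rewrite mulVf ?scale1r// pnatr_eq0 -lt0n.
Qed.

Lemma weighted_mean_recenter (w : 'I_n -> R) y mu :
  weighted_mean w (shift_sample y mu) =
  weighted_mean w (shift_sample y (sample_mean y)) +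
  (n%:R^-1 * \sum_i w i) *: (sample_mean y - mu).
Proof.
rewrite -scalerA -scalerDr; congr (_ *: _).
rewrite scaler_suml -big_split /=; apply: eq_bigr => i _.
by rewrite !tnth_mktuple -scalerDr addrA subrK.
Qed.

Context (phi : 'rV[R]_K -> R) (alpha delta : R).
Hypotheses (phi_ge0 : forall x, 0 <= phi x).
Hypotheses (phi_subadditive : subadditive_function phi).
Hypotheses (phi_homogeneous : positive_homogeneous phi).
Hypotheses (alpha01 : 0 < alpha /\ alpha < 1).
Hypotheses (delta01 : 0 < delta /\ delta < 1).
Let k := binom_upper_quantile n (alpha * delta / 2).

(** It suffices that the right-hand side is exceeded with probability at most
    alpha.  This happens only if the quantile on the empirically centred sample
    is exceeded, with probability at most (1 - delta) * alpha, or if the sum of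
    the signs exceeds its two-sided quantile, with probability at most
    alpha * delta. *)
Lemma sign_quantile_recenter y mu (b : R) :
  sym_max phi (sample_mean y - mu) <= b ->
  sign_quantile alpha phi (shift_sample y mu) <=
  sign_quantile ((1 - delta) * alpha) phi (shift_sample y (sample_mean y)) +
  (2 * k%:R - n%:R) / n%:R * b.
Proof.
move=> vb; have [[a0 a1] [d0 d1]] := (alpha01, delta01).
have eta0 : 0 < alpha * delta / 2 by rewrite divr_gt0 ?mulr_gt0.
have ad1 : alpha * delta <= 1 by rewrite mulr_ile1// ltW.
have nk : n%:R <= 2 * k%:R :> R.
  by apply: binom_upper_quantile_ge => //; lra.
have lvl01 : 0 <= (1 - delta) * alpha < 1.
  rewrite mulr_ge0 ?subr_ge0 ?ltW//= mulr_ilt1 ?subr_ge0 ?ltW//. lra.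
have a01 : 0 <= alpha < 1 by rewrite ltW.
rewrite sign_prob_inf_le//; set q := sign_quantile _ _ _.
have n0 : 0 < n%:R :> R by rewrite ltr0n.
apply: (@le_trans _ _ (sign_prob (fun A : {set 'I_n} => q <
      phi (weighted_mean (signs A) (shift_sample y (sample_mean y)))) +
    sign_prob (fun A : {set 'I_n} => 2 * k%:R - n%:R < `|\sum_i signs A i| :> R))).
  apply: sign_probU => A; apply: contraTT; rewrite negb_or -!leNgt => /andP[qA sA].
  rewrite weighted_mean_recenter (le_trans (phi_subadditive _ _))// lerD//.
  rewrite (le_trans (sublinear_scale _ _ _))// normrM ger0_norm ?invr_ge0 ?ler0n//.
  rewrite [_ / _]mulrC ler_pM// ?mulr_ge0 ?invr_ge0 ?ler0n//.
    exact: le_trans (phi_ge0 _) (le_sym_max _ _).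
  by rewrite ler_wpM2l// invr_ge0 ler0n.
have qle : sign_prob (fun A : {set 'I_n} => q <
    phi (weighted_mean (signs A) (shift_sample y (sample_mean y)))) <=
    (1 - delta) * alpha.
  by rewrite -sign_prob_inf_le.
apply: le_trans (lerD qle (ltW (@sign_prob_sum_signs_gt R n _ eta0))) _.
by rewrite le_eqVlt; apply/orP; left; apply/eqP; field.
Qed.

End recentering.

(** Induction on J: the bound b on v is first improved with the last index. *)
Lemma iterated_affine_bound {R : realType} (J : nat) (u v b : R)
    (q g gamma : nat -> R) :
  (0 < J)%N -> gamma 0%N = 1 -> (forall i, gamma i.+1 = gamma i * g i) ->
  (forall c, v <= c -> u <= q 0%N + g 0%N * c) ->
  (forall i, (0 < i < J)%N -> forall c, v <= c -> v <= q i + g i * c) ->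
  v <= b -> u <= q 0%N + \sum_(1 <= i < J) gamma i * q i + gamma J * b.
Proof.
move=> J0 gamma0 gammaS hu hv; elim: J J0 hv b => // -[|J] IH _ hv b vb.
  by rewrite big_geq// addr0 gammaS gamma0 mul1r; exact: hu.
have vJ : v <= q J.+1 + g J.+1 * b by apply: hv; rewrite ?ltnSn.
rewrite big_nat_recr//= (gammaS J.+1) -mulrA -!addrA -mulrDr addrA.
by apply: IH => // i /andP[i0 iJ]; apply: hv; rewrite i0 ltnW.
Qed.

(** * The iterated bound *)

Lemma measurable_sample_mean {R : realType} {n K : nat} :
  measurable_fun setT (fun y : n.-tuple 'rV[R]_K => sample_mean y).
Proof.
apply: measurable_fun_rVP => j; under eq_fun do rewrite mxE summxE.
apply: measurable_funM => //; apply: measurable_sum => i.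
exact: (measurableT_comp (measurable_coord j) (@measurable_tnth _ _ _ i)).
Qed.

Theorem corollary3p3
  (R : realType)
  (d : measure_display) (T : measurableType d) (P : probability T R)
  (dW : measure_display) (Omega : measurableType dW)
  (PW : probability Omega R)
  (n K J : nat) (hn : (2 <= n)%N) (hK : (1 <= K)%N) (hJ : (0 < J)%N)
  (W : 'I_n -> {RV PW >-> R})
  (W_iid : iid PW W) (W_rademacher : forall i, rademacher PW (W i))
  (Y : 'I_n -> {RV P >-> 'rV[R]_K}) (mu : 'rV[R]_K)
  (Y_iid : iid P Y)
  (Y_integrable : forall i, integrable_vector P (Y i))
  (Y_mean : forall i, has_mean P (Y i) mu)
  (Y_symmetric : forall i, symmetric_wrt P (Y i) mu)
  (alpha : nat -> R)
  (alpha01 : forall i, (i < J)%N -> 0 < alpha i /\ alpha i < 1)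
  (delta : R) (delta01 : 0 < delta /\ delta < 1)
  (phi : 'rV[R]_K -> R)
  (phi_ge0 : forall x, 0 <= phi x)
  (phi_subadditive : subadditive_function phi)
  (phi_homogeneous : positive_homogeneous phi)
  (f : n.-tuple 'rV[R]_K -> R)
  (f_ge0 : forall y, 0 <= f y)
  (f_measurable : measurable_fun setT f) :
  let Ybar t := sample_mean (sample Y t) in
  let q a psi t :=
    resampled_quantile PW W a psi (shift_sample (sample Y t) (Ybar t)) in
  let gamma := gamma_factor n alpha delta in
  is_true (P [set t |
       (phi (Ybar t - mu) >
         q ((1 - delta) * alpha 0%N) phi t
         + \sum_(1 <= i < J)
             gamma i * q ((1 - delta) * alpha i) (sym_max phi) t
         + gamma J * f (sample Y t))%R]
   <= (\sum_(0 <= i < J) alpha i)%:E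
      + P [set t | (sym_max phi (Ybar t - mu) > f (sample Y t))%R])%E.
Proof.
move=> Ybar q gamma.
have n_gt0 : (0 < n)%N by exact: ltnW.
have [d0 d1] := delta01.
pose phit := sym_max phi.
have phit_sub : subadditive_function phit by exact: sym_max_subadditive.
have phit_hom : positive_homogeneous phit by exact: sym_max_homogeneous.
have phit_ge0 x : 0 <= phit x by apply: le_trans (le_sym_max _ _).
(* Only the step of index 0 concerns phi; the others improve the bound on
   sym_max phi. *)
pose psi i := if i == 0%N then phi else phit.
have psi_sub i : subadditive_function (psi i) by rewrite /psi; case: eqP.
have psi_hom i : positive_homogeneous (psi i) by rewrite /psi; case: eqP.
have psi_ge0 i x : 0 <= psi i x by rewrite /psi; case: eqP.
have psi_max i : sym_max (psi i) = phit.
  by rewrite /psi; case: eqP => // _; exact: sym_max_idem.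
have mpsi i : measurable_fun setT (psi i) by exact: sublinear_measurable.
have a01 i : (i < J)%N -> 0 <= alpha i < 1.
  by move=> /alpha01[a0 a1]; rewrite ltW.
have b01 i : (i < J)%N -> 0 <= (1 - delta) * alpha i < 1.
  move=> /alpha01[a0 a1].
  by rewrite mulr_ge0 ?subr_ge0 ?ltW//= mulr_ilt1 ?subr_ge0 ?ltW//; lra.
have msample := @measurable_sample _ _ _ _ _ _ Y.
have mYbar : measurable_fun setT (fun y : n.-tuple 'rV[R]_K => sample_mean y).
  exact: measurable_sample_mean.
pose Z t := shift_sample (sample Y t) mu.
pose S t := shift_sample (sample Y t) (Ybar t).
pose Q i t := sign_quantile ((1 - delta) * alpha i) (psi i) (S t).
have qE i t : q ((1 - delta) * alpha i) (psi i) t = Q i t.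
  by exact: resampled_quantileE.
have mQ i : (i < J)%N -> measurable_fun setT (Q i).
  move=> iJ; apply: measurableT_comp.
    exact: (sign_quantile_measurable (b01 i iJ)).
  exact: measurableT_comp (measurable_shift_sample mYbar) msample.
have mphi i : measurable_fun setT (fun t => psi i (Ybar t - mu)).
  apply: measurableT_comp => //; apply: measurable_fun_rVP => j.
  under eq_fun do rewrite mxE.
  apply: measurable_funD => //.
  exact: (measurableT_comp (measurable_coord j) (measurableT_comp mYbar msample)).
pose E i :=
  [set t | sign_quantile (alpha i) (psi i) (Z t) < psi i (sample_mean (Z t))].
have mE i : (i < J)%N -> measurable (E i).
  move=> iJ; apply: measurable_lt_set.
    apply: measurableT_comp; first exact: (sign_quantile_measurable (a01 i iJ)).
    exact: measurableT_comp (measurable_shift_sample (measurable_cst mu)) msample.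
  by under eq_fun do rewrite sample_mean_shift//; exact: mphi.
have PE i : (i < J)%N -> (P (E i) <= (alpha i)%:E)%E.
  by move=> iJ; apply: symmetrized_quantile; [exact: Y_iid.1 | | exact: a01 | ].
pose F := [set t | f (sample Y t) < phit (Ybar t - mu)].
have mf : measurable_fun setT (fun t => f (sample Y t)).
  exact: measurableT_comp f_measurable msample.
have mF : measurable F by apply: measurable_lt_set => //; exact: (mphi 1%N).
pose bound t :=
  Q 0%N t + \sum_(1 <= i < J) gamma i * Q i t + gamma J * f (sample Y t).
have mbound : measurable_fun setT bound.
  apply: measurable_funD; last exact: measurable_funM.
  apply: measurable_funD; first exact: mQ.
  under eq_fun do rewrite big_add1 big_mkord.
  apply: measurable_sum => i; apply: measurable_funM => //; apply: mQ.
  by rewrite -ltn_predRL.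
have -> : [set t | (phi (Ybar t - mu) > q ((1 - delta) * alpha 0%N) phi t
         + \sum_(1 <= i < J) gamma i * q ((1 - delta) * alpha i) (sym_max phi) t
         + gamma J * f (sample Y t))%R] = [set t | bound t < phi (Ybar t - mu)].
  apply: eq_set => t; rewrite /bound -(qE 0%N); congr (is_true (_ + _ + _ < _)).
  by apply: eq_big_nat => -[|i]// _; rewrite -qE.
have cover : [set t | bound t < phi (Ybar t - mu)] `<=`
    \big[setU/set0]_(i < J) E i `|` F.
  move=> t; apply: contraPP => /not_orP[nE nF]; apply/negP; rewrite -leNgt.
  have vf : phit (Ybar t - mu) <= f (sample Y t) by rewrite leNgt; apply/negP.
  have step i : (i < J)%N -> forall c, phit (Ybar t - mu) <= c ->
      psi i (Ybar t - mu) <= Q i t +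
      (2 * (binom_upper_quantile n (alpha i * delta / 2))%:R - n%:R) / n%:R * c.
    move=> iJ c vc; have := sign_quantile_recenter n_gt0 (psi_ge0 i)
      (psi_sub i) (psi_hom i) (alpha01 i iJ) delta01 (y := sample Y t)
      (mu := mu) (b := c).
    rewrite psi_max => /(_ vc); apply: le_trans.
    rewrite -sample_mean_shift// leNgt; apply/negP => Et; apply: nE.
    by rewrite -bigcup_mkord; exists i.
  apply: (@iterated_affine_bound R J _ (phit (Ybar t - mu)) (f (sample Y t))
    (fun i => Q i t)
    (fun i => (2 * (binom_upper_quantile n (alpha i * delta / 2))%:R - n%:R)
              / n%:R)) => //.
  - by rewrite /gamma /gamma_factor big_ord0 expr0 invr1 mulr1.
  - move=> i; rewrite /gamma /gamma_factor big_ord_recr/= exprSr invfM.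
    by rewrite mulrACA [X in _ * X = _]mulrC.
  - exact: (step 0%N).
  - by move=> i /andP[i0 iJ] c; have := step i iJ c; rewrite /psi gtn_eqF.
apply: (@le_trans _ _ (P (\big[setU/set0]_(i < J) E i `|` F))).
  apply: le_measure; rewrite ?inE//; first exact: measurable_lt_set (mphi 0%N).
  by apply: measurableU => //; apply: bigsetU_measurable => i _; exact: mE.
apply: le_trans (measureU2 _ _ mF) _.
  by apply: bigsetU_measurable => i _; exact: mE.
apply: leeD => //; apply: le_trans (Boole_inequality _ mE) _.
rewrite big_mkord -sumEFin; apply: lee_sum => i _; exact: PE.
Qed.
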